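(* Let $\phi:\mathbb{R}^n\to\mathbb{R}$ be continuously differentiable with $L$-Lipschitz continuous gradient ($L>0$), and let $f:\mathbb{R}^n\to\mathbb{R}$ satisfy $|f(x)-\phi(x)|\le\epsilon_f$ for all $x\in\mathbb{R}^n$, where $\epsilon_f\ge 0$ is a constant. Let $\theta\in[0,\tfrac12)$, $c_1\in(0,1)$, $\tau\in(0,1)$, and suppose that $$\bar\alpha=\frac{2\left(1-2\theta-c_1(1-\theta)\right)}{L(1-\theta)}>0 .$$ Assume there is a constant $\mu>0$ such that $\phi(y)\ge\phi(x)+\nabla\phi(x)^T(y-x)+\frac{\mu}{2}\|x-y\|^2$ for all $x,y\in\mathbb{R}^n$, and let $\phi^\star=\phi(x^\star)$, where $x^\star$ is the minimizer of $\phi$. Let $\{x_k\}$ be generated from some $x_0\in\mathbb{R}^n$ by $x_{k+1}=x_k-\alpha_k g(x_k)$, where $g(x_k)\in\mathbb{R}^n$ satisfies $\|g(x_k)-\nabla\phi(x_k)\|\le\theta\|\nabla\phi(x_k)\|$ for all $k$, and where $\alpha_k>0$ is obtained by the backtracking line search described in the context and so satisfies the relaxed Armijo condition $$f(x_k-\alpha_k g(x_k))\le f(x_k)-c_1\alpha_k\|g(x_k)\|^2+2\epsilon_f .$$ Then, for $k=0,1,\dots$, $$\phi(x_k)-\left[\phi^\star+\frac{4\epsilon_f}{1-\rho}\right]\le\rho^k\left(\phi(x_0)-\left[\phi^\star+\frac{4\epsilon_f}{1-\rho}\right]\right),$$ where $\rho=1-2\mu c_1\tau\bar\alpha(1-\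theta)^2$.
   Context: $\|\cdot\|$ is the Euclidean norm. Backtracking line search: at iteration $k$ an initial trial value of the step size, which is at least $\tau\bar\alpha$, is chosen; as long as the current trial value $\alpha$ does not satisfy the relaxed Armijo condition $f(x_k-\alpha g(x_k))\le f(x_k)-c_1\alpha\|g(x_k)\|^2+2\epsilon_f$, it is replaced by $\tau\alpha$; $\alpha_k$ is the first trial value that satisfies the condition. *)

(* Defs.v *)
From HB Require Import structures.
From mathcomp Require Import all_boot all_order all_algebra.
From mathcomp Require Import all_classical all_reals all_analysis.

Set Implicit Arguments.
Unset Strict Implicit.
Unset Printing Implicit Defensive.

Import Order.TTheory GRing.Theory Num.Theory.
Import numFieldNormedType.Exports.

Local Open Scope ring_scope.

(* Vectors of R^n are row vectors.  The library's norm `|_| on matrices is the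
   max norm; it is only used for its topology (differentiability, continuity),
   which is the Euclidean one.  Quantitative statements use [enorm]. *)
Definition edot (R : realType) (n : nat) (u v : 'rV[R]_n) : R :=
  \sum_(i < n) u 0 i * v 0 i.

Definition enorm (R : realType) (n : nat) (u : 'rV[R]_n) : R :=
  Num.sqrt (edot u u).

Definition gradient (R : realType) (n : nat) (phi : 'rV[R]_n -> R)
    (x : 'rV[R]_n) : 'rV[R]_n :=
  \row_(i < n) 'D_(delta_mx 0 i) phi x.

Definition continuously_differentiable (R : realType) (n : nat)
    (phi : 'rV[R]_n -> R) : Prop :=
  (forall x : 'rV[R]_n, differentiable phi x) /\ continuous (gradient phi).

Definition relaxed_armijo (R : realType) (n : nat) (f : 'rV[R]_n -> R)
    (c1 epsf : R) (x d : 'rV[R]_n) (a : R) : Prop :=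
  f (x - a *: d) <= f x - c1 * a * enorm d ^+ 2 + 2 * epsf.

(* [a] is returned by the backtracking line search at [x] along [- d] with
   some initial trial value [a0 >= amin]: the trial values are
   a0, tau a0, tau^2 a0, ... and [a] is the first one to be accepted. *)
Definition backtracking_step (R : realType) (n : nat) (f : 'rV[R]_n -> R)
    (c1 epsf tau amin : R) (x d : 'rV[R]_n) (a : R) : Prop :=
  exists (a0 : R) (j : nat),
    [/\ amin <= a0,
        a = tau ^+ j * a0,
        relaxed_armijo f c1 epsf x d a
      & forall i : nat, (i < j)%N ->
          ~ relaxed_armijo f c1 epsf x d (tau ^+ i * a0)].

(* Main.v *)
Require Import Defs.
From HB Require Import structures.
From mathcomp Require Import all_boot all_order all_algebra.
From mathcomp Require Import all_classical all_reals all_analysis.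
From mathcomp Require Import ring lra.
Import Order.TTheory GRing.Theory Num.Theory.
Import numFieldNormedType.Exports.
Local Open Scope ring_scope.

(** Why the theorem holds.  Combining the descent inequality for [phi] with
    the relative error bound on [g] shows that every step size in [(0, abar]]
    passes the relaxed Armijo test; the [2 * epsf] slack absorbs the two
    evaluations of the inexact function [f].  Backtracking therefore never
    stops below [tau * abar] ([backtracking_step_ge]).  An accepted step
    decreases [phi] by at least [c1 * alpha * |g|^2], up to [4 * epsf], and
    [|g| >= (1 - theta) * |grad phi|]; strong convexity bounds [|grad phi|^2]
    below by [2 * mu] times the optimality gap ([polyak_lojasiewicz]).  Hence
    the gap contracts by [rho] up to the additive noise [4 * epsf]
    ([gap_contraction]), and [4 * epsf / (1 - rho)] is the fixed point of that
    affine recursion.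

    Iterating the recursion requires [0 <= rho].  This comes from [mu <= L],
    which compares the strong convexity modulus with the Lipschitz constant
    along a nonzero direction, and from
    [c1 * abar * (1 - theta)^2 * L = 2 * w * (p - w) <= p^2 / 2], where
    [w = c1 * (1 - theta)] and [p = 1 - 2 * theta <= 1]. *)

(** * Euclidean geometry of row vectors *)

Section Euclidean.
Context {R : realType} {n : nat}.
Implicit Types (u v w : 'rV[R]_n) (a s : R).

Lemma edotC u v : edot u v = edot v u.
Proof. by apply: eq_bigr => i _; rewrite mulrC. Qed.

Lemma edotDl u v w : edot (u + v) w = edot u w + edot v w.
Proof. by rewrite /edot -big_split; apply: eq_bigr => i _; rewrite !mxE mulrDl. Qed.

Lemma edotZl a u v : edot (a *: u) v = a * edot u v.
Proof. by rewrite /edot mulr_sumr; apply: eq_bigr => i _; rewrite !mxE mulrA. Qed.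

Lemma edotNl u v : edot (- u) v = - edot u v.
Proof. by rewrite -scaleN1r edotZl mulN1r. Qed.

Lemma edotBl u v w : edot (u - v) w = edot u w - edot v w.
Proof. by rewrite edotDl edotNl. Qed.

Lemma edotDr u v w : edot w (u + v) = edot w u + edot w v.
Proof. by rewrite edotC edotDl !(edotC w). Qed.

Lemma edotZr a u v : edot v (a *: u) = a * edot v u.
Proof. by rewrite edotC edotZl edotC. Qed.

Lemma edotNr u v : edot v (- u) = - edot v u.
Proof. by rewrite edotC edotNl edotC. Qed.

Lemma edotBr u v w : edot w (u - v) = edot w u - edot w v.
Proof. by rewrite edotDr edotNr. Qed.

Lemma edot_ge0 u : 0 <= edot u u.
Proof. by apply: sumr_ge0 => i _; rewrite -expr2 sqr_ge0. Qed.

Lemma edot_eq0 u : edot u u = 0 -> u = 0.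
Proof.
move/eqP; rewrite psumr_eq0 => [/allP u0|i _]; last by rewrite -expr2 sqr_ge0.
apply/rowP => i; rewrite mxE; apply/eqP.
by have := u0 i (mem_index_enum i); rewrite /= mulf_eq0 orbb.
Qed.

Lemma enorm_ge0 u : 0 <= enorm u.
Proof. exact: sqrtr_ge0. Qed.

Lemma enorm_sqr u : enorm u ^+ 2 = edot u u.
Proof. by rewrite sqr_sqrtr ?edot_ge0. Qed.

Lemma enorm_eq0 u : enorm u = 0 -> u = 0.
Proof. by move=> u0; apply: edot_eq0; rewrite -enorm_sqr u0 expr0n. Qed.

Lemma edot0l v : edot 0 v = 0.
Proof. by rewrite -(scale0r 0) edotZl mul0r. Qed.

Lemma enormZ a u : 0 <= a -> enorm (a *: u) = a * enorm u.
Proof.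
by move=> a0; rewrite /enorm edotZl edotZr mulrA -expr2 sqrtrM ?sqr_ge0// sqrtr_sqr ger0_norm.
Qed.

Lemma enormN u : enorm (- u) = enorm u.
Proof. by rewrite /enorm edotNl edotNr opprK. Qed.

(** Expands the square of [|v| u - |u| v]; when [u] and [v] are nonzero the
    common factor [2 |u| |v|] can be cancelled. *)
Lemma cauchy_schwarz u v : edot u v <= enorm u * enorm v.
Proof.
have [u0|u_neq0] := eqVneq (enorm u) 0.
  by rewrite u0 mul0r (enorm_eq0 u u0) edot0l.
have [v0|v_neq0] := eqVneq (enorm v) 0.
  by rewrite v0 mulr0 (enorm_eq0 v v0) edotC edot0l.
have uv_gt0 : 0 < enorm u * enorm v.
  by rewrite mulr_gt0// lt_neqAle eq_sym enorm_ge0 ?u_neq0 ?v_neq0.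
have := edot_ge0 (enorm v *: u - enorm u *: v).
rewrite edotBl !edotBr !edotZl !edotZr -!enorm_sqr (edotC v u) => sq_ge0.
rewrite -(ler_pM2l uv_gt0); move: sq_ge0; lra.
Qed.

Lemma enorm_triangle u v : enorm (u + v) <= enorm u + enorm v.
Proof.
rewrite -ler_sqr ?nnegrE ?addr_ge0 ?enorm_ge0//.
rewrite enorm_sqr edotDl !edotDr (edotC v u) sqrrD -!enorm_sqr.
have := cauchy_schwarz u v; lra.
Qed.

End Euclidean.

(** * Smoothness and strong convexity *)

Section Smooth.
Context {R : realType} {n : nat} (phi : 'rV[R]_n -> R).
Implicit Types (x y d : 'rV[R]_n).

Lemma derive_gradient x d :
  differentiable phi x -> 'D_d phi x = edot (gradient phi x) d.
Proof.
move=> dphi; rewrite deriveE// {1}(row_sum_delta d) linear_sum.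
by apply: eq_bigr => i _; rewrite linearZ /= mxE deriveE// mulrC.
Qed.

(** The difference quotient of [phi] along [d] at [x + t d] is, term by term,
    that of the one-variable restriction at [t]. *)
Lemma is_derive_line x d (t : R) : differentiable phi (x + t *: d) ->
  is_derive t 1 (fun s : R => phi (x + s *: d))
    (edot (gradient phi (x + t *: d)) d).
Proof.
move=> dphi; rewrite -derive_gradient//.
have quotE : (fun h : R => h^-1 *: (((fun s : R => phi (x + s *: d))
      \o shift t) (h *: (1 : R)) - phi (x + t *: d))) =
    (fun h : R => h^-1 *: ((phi \o shift (x + t *: d)) (h *: d)
      - phi (x + t *: d))).
  apply/funext => h /=; congr (_ *: (phi _ - _)).
  by rewrite [h%:A]mulr1 scalerDl addrCA.
have := @diff_derivable _ _ _ phi (x + t *: d) d dphi.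
by move=> dd; constructor; rewrite /derivable /derive quotE.
Qed.

Variable L : R.
Hypothesis phi_diff : forall x, differentiable phi x.
Hypothesis phi_lip : forall x y,
  enorm (gradient phi x - gradient phi y) <= L * enorm (x - y).

(** Along the segment from [x] to [x + d], subtracting the quadratic model from
    [phi] leaves a function of [t] with derivative
    [(grad phi (x + t d) - grad phi x) . d - L t |d|^2], which is nonpositive by
    Cauchy-Schwarz and the Lipschitz bound. *)
Lemma descent_inequality x d :
  phi (x + d) <= phi x + edot (gradient phi x) d + L / 2 * enorm d ^+ 2.
Proof.
pose c := edot (gradient phi x) d; pose q := L * enorm d ^+ 2.
pose m (t : R) := phi (x + t *: d) - (c * t + q / 2 * t ^+ 2).
pose dm (t : R) := edot (gradient phi (x + t *: d)) d - (c + q * t).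
have m_derive (t : R) : is_derive t (1 : R) m (dm t).
  have line := is_derive_line x d t (phi_diff _).
  have model : is_derive t (1 : R) (c \*: id + q / 2 \*: (id ^+ 2)) (c + q * t).
    apply: is_derive_eq.
    by rewrite /GRing.scale /=; field.
  exact: (is_deriveB line model).
have m_cont : ({within `[0%R, 1%R], continuous m})%classic.
  by apply: derivable_within_continuous => t _; exact: ex_derive.
have [t t01 m10] := @MVT _ m dm 0 1 ltr01 (fun t _ => m_derive t) m_cont.
have /andP[t_gt0 _] : (0 < t) && (t < 1) by rewrite in_itv in t01.
have dm_le0 : dm t <= 0.
  have := cauchy_schwarz (gradient phi (x + t *: d) - gradient phi x) d.
  have := phi_lip (x + t *: d) x.
  rewrite [x + _ - x]addrAC subrr add0r (enormZ _ _ (ltW t_gt0)) edotBl => lip cs.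
  have := ler_wpM2r (enorm_ge0 d) lip; rewrite /dm /q /c; lra.
move: m10; rewrite subr0 mulr1 /m scale1r scale0r addr0 => m10.
by move: dm_le0; rewrite -m10 /q /c; lra.
Qed.

Variable mu : R.
Hypothesis mu_gt0 : 0 < mu.
Hypothesis phi_sc : forall x y,
  phi x + edot (gradient phi x) (y - x) + mu / 2 * enorm (x - y) ^+ 2 <= phi y.

(** The right-hand side of the strong convexity inequality is minimized over
    all [y] by [y = x - mu^-1 grad phi x], where it equals
    [phi x - |grad phi x|^2 / (2 mu)]. *)
Lemma polyak_lojasiewicz x y :
  2 * mu * (phi x - phi y) <= enorm (gradient phi x) ^+ 2.
Proof.
have := edot_ge0 (gradient phi x + mu *: (y - x)).
rewrite edotDl !edotDr !edotZl !edotZr -!enorm_sqr (edotC (y - x)) => sq_ge0.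
have := phi_sc x y; rewrite -enormN opprB => sc.
have := ler_wpM2l (ltW mu_gt0) sc; lra.
Qed.

(** Adding the strong convexity inequalities at [(x, y)] and [(y, x)] gives
    [mu |x - y|^2 <= (grad phi x - grad phi y) . (x - y)], which the Lipschitz
    bound caps by [L |x - y|^2]; a nonzero [x - y] exists only in positive
    dimension. *)
Lemma strong_convexity_le_lipschitz : (0 < n)%N -> mu <= L.
Proof.
case: n phi phi_lip phi_sc => // p psi psi_lip psi_sc _.
pose e : 'rV[R]_p.+1 := const_mx 1.
have e_gt0 : 0 < enorm e ^+ 2.
  rewrite lt_neqAle sqr_ge0 andbT eq_sym enorm_sqr.
  apply/eqP => /edot_eq0/rowP/(_ 0)/eqP; by rewrite !mxE oner_eq0.
have cs := cauchy_schwarz (gradient psi e - gradient psi 0) e.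
have := psi_lip e 0; rewrite subr0 => lip.
have lip2 := ler_wpM2r (enorm_ge0 e) lip.
have := psi_sc e 0; have := psi_sc 0 e.
rewrite !sub0r subr0 enormN edotNr => sc1 sc2.
rewrite edotBl in cs.
rewrite -(ler_pM2r e_gt0); lra.
Qed.

End Smooth.

(** * Relative gradient errors and the line search *)

Section RelativeError.
Context {R : realType} {n : nat} (theta : R) (g d : 'rV[R]_n).
Hypothesis g_err : enorm (g - d) <= theta * enorm d.

Lemma relative_error_norm : (1 - theta) * enorm d <= enorm g.
Proof.
have := enorm_triangle g (d - g); rewrite addrC subrK -(enormN (d - g)) opprB.
move: g_err; lra.
Qed.

(** Writes [d . g] as [|g|^2 - (g - d) . g], and bounds [|g - d|] by
    [theta / (1 - theta) * |g|] using [relative_error_norm]. *)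
Lemma relative_error_dot : 0 <= theta -> theta < 1 ->
  (1 - 2 * theta) / (1 - theta) * enorm g ^+ 2 <= edot d g.
Proof.
move=> theta_ge0 theta_lt1; have t_gt0 : 0 < 1 - theta by rewrite subr_gt0.
rewrite mulrAC ler_pdivrMr//.
have := cauchy_schwarz (g - d) g; rewrite edotBl -enorm_sqr => cs.
have err := ler_wpM2r (enorm_ge0 g) (ler_wpM2l (ltW t_gt0) g_err).
have nrm := ler_wpM2r (enorm_ge0 g) (ler_wpM2l theta_ge0 relative_error_norm).
have := ler_wpM2l (ltW t_gt0) cs; lra.
Qed.

End RelativeError.

Section LineSearch.
Context {R : realType} {n : nat} (phi f : 'rV[R]_n -> R).
Variables (L epsf theta c1 tau abar : R).
Hypothesis phi_diff : forall x, differentiable phi x.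
Hypothesis phi_lip : forall x y,
  enorm (gradient phi x - gradient phi y) <= L * enorm (x - y).
Hypothesis L_gt0 : 0 < L.
Hypothesis f_err : forall x, `|f x - phi x| <= epsf.
Hypothesis theta_ge0 : 0 <= theta.
Hypothesis theta_lt : theta < 1 / 2.
Hypothesis abarE :
  abar = 2 * (1 - 2 * theta - c1 * (1 - theta)) / (L * (1 - theta)).
Implicit Types (x g : 'rV[R]_n) (a : R).

(** [abar] is the step size at which the decrease guaranteed by the descent
    inequality, [a * ((1 - 2 theta) / (1 - theta) - L a / 2) * |g|^2], equals
    [c1 * a * |g|^2]. *)
Lemma short_step_accepted x g a :
  enorm (g - gradient phi x) <= theta * enorm (gradient phi x) ->
  0 < a -> a <= abar -> relaxed_armijo f c1 epsf x g a.
Proof.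
move=> g_err a_gt0 a_le; have t_gt0 : 0 < 1 - theta by move: theta_lt; lra.
have theta_lt1 : theta < 1 by move: theta_lt; lra.
have dot := relative_error_dot _ _ _ g_err theta_ge0 theta_lt1.
have := descent_inequality phi L phi_diff phi_lip x (- (a *: g)).
rewrite enormN (enormZ _ _ (ltW a_gt0)) edotNr edotZr exprMn => desc.
have model : L / 2 * a <= (1 - 2 * theta) / (1 - theta) - c1.
  have -> : (1 - 2 * theta) / (1 - theta) - c1 = L / 2 * abar.
    by rewrite abarE; field; rewrite !gt_eqF.
  by rewrite ler_pM2l// divr_gt0.
have slope : L / 2 * a * enorm g ^+ 2 <=
    edot (gradient phi x) g - c1 * enorm g ^+ 2.
  apply: le_trans (ler_wpM2r (sqr_ge0 _) model) _.
  by rewrite mulrBl lerD2r.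
have := ler_wpM2l (ltW a_gt0) slope.
have := f_err x; have := f_err (x - a *: g).
rewrite /relaxed_armijo !ler_norml => /andP[_ fa] /andP[fx _]; lra.
Qed.

(** If some trial value was rejected, the last rejected one exceeded [abar], and
    the returned value is [tau] times it; otherwise the initial trial value is
    returned. *)
Lemma backtracking_step_ge x g a :
  0 < abar -> 0 < tau ->
  enorm (g - gradient phi x) <= theta * enorm (gradient phi x) ->
  backtracking_step f c1 epsf tau (tau * abar) x g a -> tau * abar <= a.
Proof.
move=> abar_gt0 tau_gt0 g_err [a0 [[|j] [a0_ge -> _ rejected]]].
  by rewrite mul1r.
rewrite exprS -mulrA ler_pM2l// leNgt; apply/negP => /ltW short.
apply: (rejected j) => //; apply: short_step_accepted => //.
by rewrite mulr_gt0 ?exprn_gt0// (lt_le_trans _ a0_ge)// mulr_gt0.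
Qed.

Lemma accepted_step_decrease x g a : relaxed_armijo f c1 epsf x g a ->
  phi (x - a *: g) <= phi x - c1 * a * enorm g ^+ 2 + 4 * epsf.
Proof.
have := f_err x; have := f_err (x - a *: g).
rewrite /relaxed_armijo !ler_norml => /andP[fa _] /andP[_ fx]; lra.
Qed.

(** * Contraction of the optimality gap *)

Variable mu : R.
Hypothesis mu_gt0 : 0 < mu.
Hypothesis phi_sc : forall x y,
  phi x + edot (gradient phi x) (y - x) + mu / 2 * enorm (x - y) ^+ 2 <= phi y.
Hypothesis c1_gt0 : 0 < c1.
Hypothesis tau_gt0 : 0 < tau.
Hypothesis abar_gt0 : 0 < abar.
Let rho := 1 - 2 * mu * c1 * tau * abar * (1 - theta) ^+ 2.

Lemma gap_contraction x y g a :
  enorm (g - gradient phi x) <= theta * enorm (gradient phi x) ->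
  backtracking_step f c1 epsf tau (tau * abar) x g a ->
  phi (x - a *: g) - phi y <= rho * (phi x - phi y) + 4 * epsf.
Proof.
move=> g_err ls; have t_gt0 : 0 < 1 - theta by move: theta_lt; lra.
have a_ge := backtracking_step_ge _ _ _ abar_gt0 tau_gt0 g_err ls.
have [a0 [j [_ _ /accepted_step_decrease dec _]]] := ls.
have g_ge : (1 - theta) ^+ 2 * enorm (gradient phi x) ^+ 2 <= enorm g ^+ 2.
  rewrite -exprMn ler_sqr ?nnegrE ?enorm_ge0 ?mulr_ge0 ?enorm_ge0 ?(ltW t_gt0)//.
  exact: relative_error_norm.
have pl := polyak_lojasiewicz phi mu mu_gt0 phi_sc x y.
have step : c1 * (tau * abar) * ((1 - theta) ^+ 2 * (2 * mu * (phi x - phi y)))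
    <= c1 * a * enorm g ^+ 2.
  apply: le_trans (ler_wpM2r (sqr_ge0 _) (ler_wpM2l (ltW c1_gt0) a_ge)).
  rewrite ler_wpM2l ?(ltW (mulr_gt0 c1_gt0 (mulr_gt0 tau_gt0 abar_gt0)))//.
  by apply: le_trans g_ge; rewrite ler_wpM2l ?sqr_ge0.
by rewrite /rho; lra.
Qed.

Lemma rho_lt1 : rho < 1.
Proof.
have t_gt0 : 0 < 1 - theta by move: theta_lt; lra.
by rewrite /rho gtrBl !mulr_gt0.
Qed.

Lemma rho_ge0 : (0 < n)%N -> tau < 1 -> 0 <= rho.
Proof.
move=> n_gt0 tau_lt1; have t_gt0 : 0 < 1 - theta by move: theta_lt; lra.
have mu_le : mu <= L by exact: (strong_convexity_le_lipschitz phi).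
pose w := c1 * (1 - theta); pose p := 1 - 2 * theta.
have prodE : L * (c1 * abar * (1 - theta) ^+ 2) = 2 * w * (p - w).
  by rewrite /w /p abarE; field; rewrite !gt_eqF.
have q_ge0 : 0 <= c1 * abar * (1 - theta) ^+ 2.
  by rewrite !mulr_ge0 ?sqr_ge0 ?ltW.
have q_le : mu * (c1 * abar * (1 - theta) ^+ 2) <= 1 / 2.
  apply: le_trans (ler_wpM2r q_ge0 mu_le) _; rewrite prodE.
  have : p ^+ 2 <= 1 by rewrite expr_le1//; move: theta_ge0 theta_lt; rewrite /p; lra.
  (* The square vanishes where the parabola [w * (p - w)] peaks. *)
  have := sqr_ge0 (p - 2 * w); lra.
have mq_ge0 : 0 <= mu * (c1 * abar * (1 - theta) ^+ 2) by rewrite mulr_ge0 ?(ltW mu_gt0).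
have := ler_wpM2r mq_ge0 (ltW tau_lt1); rewrite /rho; lra.
Qed.

End LineSearch.

(** [b / (1 - r)] is the fixed point of [e |-> r * e + b]. *)
Lemma affine_recursion_bound (R : realFieldType) (r b : R) (e : nat -> R) :
  0 <= r -> r < 1 -> (forall k, e k.+1 <= r * e k + b) ->
  forall k, e k - b / (1 - r) <= r ^+ k * (e 0%N - b / (1 - r)).
Proof.
move=> r_ge0 r_lt1 e_step; elim=> [|k IHk]; first by rewrite mul1r.
have fixE : b = (1 - r) * (b / (1 - r)).
  by field; rewrite gt_eqF ?subr_gt0.
rewrite exprS -mulrA; apply: le_trans (ler_wpM2l r_ge0 IHk).
by have := e_step k; rewrite {1}fixE; lra.
Qed.

Theorem theorem2p8 (R : realType) (n : nat) (n_gt0 : (0 < n)%N)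
  (phi f : 'rV[R]_n -> R) (L epsf theta c1 tau abar mu rho : R)
  (phi_C1 : continuously_differentiable phi)
  (L_gt0 : 0 < L)
  (phi_lip : forall x y : 'rV[R]_n,
     enorm (gradient phi x - gradient phi y) <= L * enorm (x - y))
  (epsf_ge0 : 0 <= epsf)
  (f_err : forall x : 'rV[R]_n, `|f x - phi x| <= epsf)
  (theta_ge0 : 0 <= theta) (theta_lt : theta < 1 / 2)
  (c1_gt0 : 0 < c1) (c1_lt1 : c1 < 1)
  (tau_gt0 : 0 < tau) (tau_lt1 : tau < 1)
  (abarE : abar = 2 * (1 - 2 * theta - c1 * (1 - theta)) / (L * (1 - theta)))
  (abar_gt0 : 0 < abar)
  (mu_gt0 : 0 < mu)
  (phi_sc : forall x y : 'rV[R]_n,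
     phi y >= phi x + edot (gradient phi x) (y - x)
              + mu / 2 * enorm (x - y) ^+ 2)
  (xstar : 'rV[R]_n)
  (xstar_min : forall y : 'rV[R]_n, phi xstar <= phi y)
  (g : 'rV[R]_n -> 'rV[R]_n) (x : nat -> 'rV[R]_n) (alpha : nat -> R)
  (x_step : forall k : nat, x k.+1 = x k - alpha k *: g (x k))
  (g_err : forall k : nat,
     enorm (g (x k) - gradient phi (x k)) <= theta * enorm (gradient phi (x k)))
  (alpha_gt0 : forall k : nat, 0 < alpha k)
  (alpha_ls : forall k : nat,
     backtracking_step f c1 epsf tau (tau * abar) (x k) (g (x k)) (alpha k))
  (rhoE : rho = 1 - 2 * mu * c1 * tau * abar * (1 - theta) ^+ 2) :
  forall k : nat,
    phi (x k) - (phi xstar + 4 * epsf / (1 - rho))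
      <= rho ^+ k * (phi (x 0%N) - (phi xstar + 4 * epsf / (1 - rho))).
Proof.
have phi_diff := phi_C1.1.
have r_ge0 : 0 <= rho.
  by rewrite rhoE; apply: (@rho_ge0 _ _ phi L).
have r_lt1 : rho < 1 by rewrite rhoE; apply: rho_lt1.
have e_step k :
    phi (x k.+1) - phi xstar <= rho * (phi (x k) - phi xstar) + 4 * epsf.
  by rewrite x_step rhoE; apply: (@gap_contraction _ _ phi f L).
move=> k.
have := affine_recursion_bound _ _ _ (fun k => phi (x k) - phi xstar)
  r_ge0 r_lt1 e_step k.
by rewrite !opprD !addrA.
Qed.
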